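(* Let $r, n_u \geq 1$, let $M, C \in \mathbb{R}^{r\times r}$ and $B \in \mathbb{R}^{r \times n_u}$ be constant matrices, and let $g: \mathbb{R}^r \to \mathbb{R}$ be a differentiable function. Consider the system $$M\ddot{x}(t) + C\dot{x}(t) + \nabla g(x(t)) = B u(t), \qquad x(t) \in \mathbb{R}^r .$$ Suppose that: (I) $M = M^{\mathrm{T}} \succ 0$ (symmetric positive definite); (II) $C = C^{\mathrm{T}} \succeq 0$ (symmetric positive semidefinite); (III) $g$ is radially unbounded and positive semidefinite (as a function). Then the solutions of the system with $u(t) = 0$ are globally uniformly bounded.
   Context: The full state is $z(t) := \begin{bmatrix} x(t)^{\mathrm{T}} & \dot{x}(t)^{\mathrm{T}}\end{bmatrix}^{\mathrm{T}} \in \mathbb{R}^{2r}$, and $\|\cdot\|$ is the Euclidean norm. A solution with $u=0$ is a twice differentiable function $x:[0,\infty)\to\mathbb{R}^r$ satisfying the equation with $u(t)=0$ for all $t \geq 0$. Global uniform boundedness: the solutions are globally uniformly bounded if, for $u(t)=0$, given an arbitrary initial condition $z(0)$, there exists a constant $K$ such that $\|z(t)\| \leq K$ for all $t \geq 0$. A function $\theta: \mathbb{R}^{m} \to \mathbb{R}$ is radially unbounded if $\theta(x) \to \infty$ whenever $\|x\| \to \infty$. It is positive semidefinite if $\theta(0)=0$ and $\theta(x) \geq 0$ for all $x \neq 0$. *)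

(* Defs.v *)
From HB Require Import structures.
From mathcomp Require Import all_boot all_order all_algebra.
From mathcomp Require Import all_classical all_reals all_analysis.

Set Implicit Arguments.
Unset Strict Implicit.
Unset Printing Implicit Defensive.

Import Order.TTheory GRing.Theory Num.Theory.
Import numFieldNormedType.Exports.

Local Open Scope classical_set_scope.
Local Open Scope ring_scope.

(* The library norm on matrices is the sup norm; it induces the same topology,
   so it is used for limits and differentiability, while [enorm] is used
   wherever the size of a vector matters. *)
Definition enorm (R : realType) (n : nat) (v : 'cV[R]_n) : R :=
  Num.sqrt (\sum_(i < n) v i 0 ^+ 2).

Definition posdefmx (R : realType) (n : nat) (A : 'M[R]_n) : Prop :=
  forall v : 'cV[R]_n, v != 0 -> 0 < (v^T *m A *m v) 0 0.

Definition possemidefmx (R : realType) (n : nat) (A : 'M[R]_n) : Prop :=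
  forall v : 'cV[R]_n, 0 <= (v^T *m A *m v) 0 0.

Definition radially_unbounded (R : realType) (m : nat)
    (theta : 'cV[R]_m -> R) : Prop :=
  forall a : R, exists rho : R,
    forall x : 'cV[R]_m, rho <= enorm x -> a <= theta x.

Definition possemidef_fun (R : realType) (m : nat)
    (theta : 'cV[R]_m -> R) : Prop :=
  theta 0 = 0 /\ forall x : 'cV[R]_m, x != 0 -> 0 <= theta x.

Definition gradient (R : realType) (m : nat) (g : 'cV[R]_m -> R)
    (x : 'cV[R]_m) : 'cV[R]_m :=
  \col_(i < m) 'D_(delta_mx i 0) g x.

(* Functions of time are defined on [0, +oo). They are represented by total
   functions on R whose values at negative times are never used: difference
   quotients only involve times t + h >= 0, so the derivative is the usual one
   for t > 0 and the right derivative at t = 0. *)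
Definition time_quot (R : realType) (n : nat) (x : R -> 'cV[R]_n) (t : R) :
    set_system 'cV[R]_n :=
  h^-1 *: (x (t + h) - x t) @[h --> within [set h | 0 <= t + h] 0^'].

Definition time_derivable (R : realType) (n : nat)
    (x : R -> 'cV[R]_n) : Prop :=
  forall t, 0 <= t -> cvg (time_quot x t).

Definition time_deriv (R : realType) (n : nat) (x : R -> 'cV[R]_n) (t : R) :
    'cV[R]_n :=
  lim (time_quot x t).

Definition full_state (R : realType) (r : nat) (x : R -> 'cV[R]_r) (t : R) :
    'cV[R]_(r + r) :=
  col_mx (x t) (time_deriv x t).

Definition is_solution (R : realType) (r nu : nat) (M C : 'M[R]_r)
    (B : 'M[R]_(r, nu)) (g : 'cV[R]_r -> R) (u : R -> 'cV[R]_nu)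
    (x : R -> 'cV[R]_r) : Prop :=
  [/\ time_derivable x, time_derivable (time_deriv x) &
      forall t, 0 <= t ->
        M *m time_deriv (time_deriv x) t + C *m time_deriv x t
          + gradient g (x t) = B *m u t].

(* The bound depends on the initial state only; as g is merely differentiable,
   several solutions may share one initial state. *)
Definition globally_uniformly_bounded (R : realType) (r nu : nat)
    (M C : 'M[R]_r) (B : 'M[R]_(r, nu)) (g : 'cV[R]_r -> R) : Prop :=
  forall z0 : 'cV[R]_(r + r), exists K : R,
    forall x : R -> 'cV[R]_r,
      is_solution M C B g (fun _ => 0) x -> full_state x 0 = z0 ->
      forall t, 0 <= t -> enorm (full_state x t) <= K.

(* Main.v *)
Require Import Defs.
From mathcomp Require Import all_boot all_order all_algebra.
From mathcomp Require Import all_classical all_reals all_analysis.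
From mathcomp Require Import ring lra.
Import Order.TTheory GRing.Theory Num.Theory.
Import numFieldNormedType.Exports.
Local Open Scope ring_scope.

(** The theorem is the decay of mechanical energy.  Along a solution of the
unforced system put E(t) = x'(t)^T M x'(t) / 2 + g(x(t)).  By the symmetry of
[M] and the equation of motion, E'(t) = x'(t)^T (M x'' + grad g (x))
= - x'(t)^T C x'(t) <= 0 for t > 0 ([is_derive_energy]); as E is continuous on
the closed half-line, E(t) <= E(0) for all t >= 0 ([energy_nonincreasing]), and
E(0) is a function of the initial state alone.

Both terms of the energy are nonnegative, so each is at most E(0).  For the
potential term, radial unboundedness of [g] gives a radius rho with
g >= E(0) + 1 outside the ball of radius rho, hence |x(t)| <= rho.  For the
kinetic term, |v|^2 <= tr(M^-1) v^T M v ([enorm_sqr_le_qform]), hence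
|x'(t)|^2 <= 2 tr(M^-1) E(0).  The constant tr(M^-1) comes from the
Cauchy-Schwarz inequality for the inner product defined by [M], applied to [v]
and the vectors M^-1 e_i, which represent the coordinates of [v]; this is
algebraic, and tr(M^-1) stands in for the inverse of the smallest eigenvalue of
[M]. *)

(** * Euclidean norm *)

Lemma enorm_sqr {R : realType} {n} (v : 'cV[R]_n) :
  enorm v ^+ 2 = \sum_i v i 0 ^+ 2.
Proof. by rewrite sqr_sqrtr// sumr_ge0// => i _; exact: sqr_ge0. Qed.

Lemma enorm_col_mx {R : realType} {m n} (u : 'cV[R]_m) (v : 'cV[R]_n) :
  enorm (col_mx u v) ^+ 2 = enorm u ^+ 2 + enorm v ^+ 2.
Proof.
rewrite !enorm_sqr big_split_ord /=; congr (_ + _).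
  by apply: eq_bigr => i _; rewrite col_mxEu.
by apply: eq_bigr => i _; rewrite col_mxEd.
Qed.

(** * Quadratic forms of positive definite matrices *)

Section QuadraticForm.
Context {R : realType} {n : nat}.
Implicit Types (A M : 'M[R]_n) (u v w : 'cV[R]_n).

Definition bform A u v : R := (u^T *m A *m v) 0 0.

Lemma bformE A u v : bform A u v = \sum_j \sum_i u i 0 * A i j * v j 0.
Proof.
rewrite /bform mxE; apply: eq_bigr => j _.
by rewrite mxE mulr_suml; apply: eq_bigr => i _; rewrite mxE.
Qed.

Lemma bformDl A u v w : bform A (u + v) w = bform A u w + bform A v w.
Proof. by rewrite /bform linearD /= !mulmxDl mxE. Qed.

Lemma bformDr A u v w : bform A u (v + w) = bform A u v + bform A u w.
Proof. by rewrite /bform mulmxDr mxE. Qed.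

Lemma bformZl A a u v : bform A (a *: u) v = a * bform A u v.
Proof. by rewrite /bform linearZ /= -!scalemxAl mxE. Qed.

Lemma bformZr A a u v : bform A u (a *: v) = a * bform A u v.
Proof. by rewrite /bform -scalemxAr mxE. Qed.

Lemma bform_sym A u v : A = A^T -> bform A u v = bform A v u.
Proof.
move=> sA; rewrite /bform -[in LHS](trmxK (u^T *m A *m v)) [in LHS]mxE.
by rewrite !trmx_mul trmxK -sA mulmxA.
Qed.

Lemma posdefmx_ge0 M v : posdefmx M -> 0 <= bform M v v.
Proof.
move=> pM; have [->|/pM/ltW//] := eqVneq v 0.
by rewrite /bform mulmx0 mxE.
Qed.

Lemma posdefmx_unit M : posdefmx M -> M \in unitmx.
Proof.
move=> pM; rewrite -unitmx_tr unitmxE unitfE; apply/negP => /det0P[v v0 vM].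
have := pM v^T; rewrite trmx_eq0 => /(_ v0).
rewrite trmxK -mulmxA (_ : M *m v^T = 0) ?mulmx0 ?mxE ?ltxx//.
by apply: trmx_inj; rewrite trmx_mul trmxK vM trmx0.
Qed.

(** Expand [0 <= bform M w w] for the multiple [w] by [bform M v v] of the part
of [u] that is orthogonal to [v]. *)
Lemma bform_cauchy_schwarz M u v : M = M^T -> posdefmx M ->
  bform M u v ^+ 2 <= bform M u u * bform M v v.
Proof.
move=> sM pM; have [->|v0] := eqVneq v 0.
  by rewrite /bform !mulmx0 mxE expr2 !mulr0.
have vv : 0 < bform M v v by exact: pM.
have := posdefmx_ge0 M (bform M v v *: u + (- bform M u v) *: v) pM.
rewrite !(bformDl, bformDr, bformZl, bformZr) (bform_sym M v u)//.
move: (bform M v v) (bform M u u) (bform M u v) vv => a b c a0 H.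
rewrite -subr_ge0 -(pmulr_rge0 _ a0).
by apply: le_trans H _; rewrite le_eqVlt; apply/orP; left; apply/eqP; ring.
Qed.

(** In the inner product of [M], the [i]-th coordinate is represented by
[M^-1 e_i]. *)
Lemma bform_invmx_delta M v i : M = M^T -> posdefmx M ->
  bform M (invmx M *m delta_mx i 0) v = v i 0.
Proof.
move=> sM pM; have uM := posdefmx_unit _ pM.
rewrite bform_sym// /bform -!mulmxA mulKVmx// mxE (bigD1 i)//= big1.
  by rewrite addr0 !mxE !eqxx mulr1.
by move=> j ji; rewrite !mxE (negbTE ji) mulr0.
Qed.

Lemma invmx_diagE M i : M = M^T -> posdefmx M ->
  invmx M i i = bform M (invmx M *m delta_mx i 0) (invmx M *m delta_mx i 0).
Proof. by move=> sM pM; rewrite bform_invmx_delta// -colE mxE. Qed.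

Lemma tr_invmx_ge0 M : M = M^T -> posdefmx M -> 0 <= \tr (invmx M).
Proof.
move=> sM pM; apply: sumr_ge0 => i _.
by rewrite invmx_diagE//; exact: posdefmx_ge0.
Qed.

(** Cauchy-Schwarz against the representing vector [M^-1 e_i], whose squared
length is [M^-1 i i]. *)
Lemma coord_sqr_le M v i : M = M^T -> posdefmx M ->
  v i 0 ^+ 2 <= invmx M i i * bform M v v.
Proof.
move=> sM pM; rewrite invmx_diagE// -{1}(bform_invmx_delta M v i sM pM).
exact: bform_cauchy_schwarz.
Qed.

(** Summing the coordinate bounds turns the diagonal of [M^-1] into its trace. *)
Lemma enorm_sqr_le_qform M v : M = M^T -> posdefmx M ->
  enorm v ^+ 2 <= \tr (invmx M) * bform M v v.
Proof.
move=> sM pM; rewrite enorm_sqr mulr_suml.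
by apply: ler_sum => i _; exact: coord_sqr_le.
Qed.

(** * Derivatives of quadratic forms *)

Lemma is_derive_coord v w i : is_derive v w (fun u : 'cV[R]_n => u i 0) (w i 0).
Proof.
have d : derivable (fun u : 'cV[R]_n => u) v w by exact: derivable_id.
apply: DeriveDef; first by have /derivable_mxP/(_ i 0) := d.
have := derive_mx d; rewrite derive_id => /matrixP/(_ i 0).
by rewrite mxE.
Qed.

(** The form as a sum of products of functions, the shape on which the rules of
differentiation act. *)
Lemma qform_fctE A : (fun v => bform A v v) =
  \sum_j \sum_i ((fun v : 'cV[R]_n => v i 0) * cst (A i j) * (fun v => v j 0)).
Proof.
apply/funext => v; rewrite bformE fct_sumE; apply: eq_bigr => j _.
by rewrite fct_sumE.
Qed.

Lemma differentiable_qform A v : differentiable (fun v => bform A v v) v.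
Proof.
rewrite qform_fctE; apply: differentiable_sum => j.
apply: differentiable_sum => i.
apply: differentiableM; last exact: differentiable_coord.
by apply: differentiableM; [exact: differentiable_coord|exact: differentiable_cst].
Qed.

Lemma derive_qform A v w :
  'D_w (fun v => bform A v v) v = bform A v w + bform A w v.
Proof.
rewrite qform_fctE !bformE.
have -> : \sum_j \sum_i v i 0 * A i j * w j 0 + \sum_j \sum_i w i 0 * A i j * v j 0
  = \sum_j \sum_i (v i 0 * A i j * w j 0 + w i 0 * A i j * v j 0).
  by rewrite -big_split; apply: eq_bigr => j _; rewrite big_split.
apply: derive_val.
apply: is_derive_sum => j; apply: is_derive_sum => i.
have ci := is_derive_coord v w i.
have cj := is_derive_coord v w j.
apply: is_derive_eq.
by rewrite scaler0 add0r /GRing.scale mulrfctE /=; ring.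
Qed.

End QuadraticForm.

(** * Derivatives on the half-line of times *)

Section TimeDerivative.
Local Open Scope classical_set_scope.
Context {R : realType} {n : nat}.
Implicit Types (x : R -> 'cV[R]_n) (t : R).

(** At a positive time the constraint [0 <= t + h] holds for all small [h], so
the one-sided difference quotient has the same limit as the usual one. *)
Lemma is_derive_time x t : time_derivable x -> 0 < t ->
  is_derive t 1 x (time_deriv x t).
Proof.
move=> dx t0.
have tE : (fun h : R => h^-1 *: (x (h *: (1 : R) + t) - x t)) =
    (fun h => h^-1 *: (x (t + h) - x t)).
  by apply/funext => h; rewrite [_%:A]mulr1 (addrC h).
have xt : h^-1 *: (x (h *: (1 : R) + t) - x t) @[h --> 0^'] --> time_deriv x t.
  rewrite tE; apply: cvg_trans (dx t (ltW t0)); apply: cvg_app.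
  move=> P PP0; have PP : \forall h \near 0^', 0 <= t + h -> P h by exact: PP0.
  near=> h; apply: (near PP h) => //=.
  have : `|h| <= t by near: h; exact: dnbhs0_le.
  by rewrite ler_norml => /andP[]; rewrite -subr_ge0 opprK addrC.
by apply: DeriveDef; [apply/cvg_ex; exists (time_deriv x t)|exact: cvg_lim].
Unshelve. all: by end_near.
Qed.

(** At time [0] only a right derivative is available; it still gives right
continuity, because [x h] is [x 0] plus [h] times the difference quotient. *)
Lemma time_derivable_continuous x : time_derivable x ->
  {within `[0, +oo[%classic, continuous x}.
Proof.
move=> dx; apply/continuous_within_itvcyP; split=> [t|].
  rewrite in_itv/= andbT => t0.
  apply/differentiable_continuous/derivable1_diffP.
  exact: (@ex_derive _ _ _ _ _ _ _ (is_derive_time x t dx t0)).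
have q : h^-1 *: (x h - x 0) @[h --> 0^'+] --> time_deriv x 0.
  have xE : (fun h : R => h^-1 *: (x h - x 0)) =
      (fun h => h^-1 *: (x (0 + h) - x 0)).
    by apply/funext => h; rewrite add0r.
  rewrite xE; apply: cvg_trans (dx 0 (lexx _)); apply: cvg_app.
  move=> P PP0.
  have PP : \forall h \near (0 : R), h != 0 -> 0 <= 0 + h -> P h by exact: PP0.
  suff H : \forall h \near (0 : R), 0 < h -> P h by exact: H.
  near=> h => h_gt0.
  by apply: (near PP h) => //; rewrite ?add0r ?gt_eqF ?ltW.
have h0 : h @[h --> (0 : R)^'+] --> (0 : R).
  exact: cvg_within.
have hq : h *: (h^-1 *: (x h - x 0)) + x 0 @[h --> (0 : R)^'+] --> x 0.
  rewrite -[X in _ --> X]add0r -(scale0r (time_deriv x 0)).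
  by apply: cvgD; [exact: cvgZ|exact: cvg_cst].
apply: cvg_trans hq; apply: near_eq_cvg; near=> h.
by rewrite scalerA divff ?scale1r ?subrK// gt_eqF.
Unshelve. all: by end_near.
Qed.

End TimeDerivative.

(** * Chain rule along a curve *)

Lemma is_derive1_diff_comp {R : realType} {V W : normedModType R} (f : V -> W)
    (x : R -> V) (t : R) (dx : V) :
  is_derive t 1 x dx -> differentiable f (x t) ->
  is_derive t 1 (f \o x) ('D_dx f (x t)).
Proof.
move=> [/derivable1_diffP dxt <-] df.
have dfx : differentiable (f \o x) t by exact: differentiable_comp.
apply: DeriveDef; first exact/derivable1_diffP.
by rewrite !deriveE// diff_comp.
Qed.

Lemma derive_gradient {R : realType} {n} (g : 'cV[R]_n -> R) (x v : 'cV[R]_n) :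
  differentiable g x -> 'D_v g x = (v^T *m gradient g x) 0 0.
Proof.
move=> dg; rewrite deriveE// mxE [in LHS](matrix_sum_delta v) linear_sum /=.
by apply: eq_bigr => i _; rewrite big_ord1 linearZ /= !mxE deriveE.
Qed.

(** * Energy of the system *)

Section Energy.
Local Open Scope classical_set_scope.
Context {R : realType} {n nu : nat}.
Implicit Types (M C : 'M[R]_n) (B : 'M[R]_(n, nu)) (g : 'cV[R]_n -> R).
Implicit Types x : R -> 'cV[R]_n.

Definition energy M g (q v : 'cV[R]_n) : R := 2^-1 * bform M v v + g q.

Definition energy_along M g x (t : R) : R := energy M g (x t) (time_deriv x t).

(** The power [v^T (M a + grad g)] reduces, by the equation of motion, to the
rate of dissipation. *)
Lemma is_derive_energy M C B g x (t : R) :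
  M = M^T -> (forall q : 'cV[R]_n, differentiable g q) ->
  is_solution M C B g (fun _ => 0) x -> 0 < t ->
  is_derive t 1 (energy_along M g x)
    (- bform C (time_deriv x t) (time_deriv x t)).
Proof.
move=> sM dg [dx dv motion] t0.
set v := time_deriv x t; set a := time_deriv (time_deriv x) t.
have dK := is_derive1_diff_comp _ _ _ _ (is_derive_time (time_deriv x) t dv t0)
  (differentiable_qform M v).
have dP := is_derive1_diff_comp _ _ _ _ (is_derive_time x t dx t0) (dg (x t)).
have -> : energy_along M g x =
    2^-1 \*: ((fun v => bform M v v) \o time_deriv x) + (g \o x) by [].
apply: is_derive_eq.
have powerE : bform M v a + bform C v v + (v^T *m gradient g (x t)) 0 0 = 0.
  have := congr1 (fun w => (v^T *m w) 0 0) (motion t (ltW t0)).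
  rewrite /bform -/v -/a !mulmxDr !mulmx0 !mulmxA.
  move: (v^T *m M *m a) (v^T *m C *m v) (v^T *m gradient g _) => p c w.
  by rewrite !mxE.
rewrite derive_qform derive_gradient// -/v -/a (bform_sym _ a v sM).
by rewrite /GRing.scale/=; lra.
Qed.

Lemma continuous_energy M C B g x :
  (forall q : 'cV[R]_n, differentiable g q) ->
  is_solution M C B g (fun _ => 0) x ->
  {within `[0, +oo[%classic, continuous (energy_along M g x)}.
Proof.
move=> dg [dx dv _] s.
pose halfline := subspace `[(0 : R), +oo[%classic.
apply: cvgD.
  apply: cvgM; first exact: cvg_cst.
  apply: (@continuous_comp halfline _ _ (time_deriv x) (fun v => bform M v v)).
    exact: time_derivable_continuous.
  exact/differentiable_continuous/differentiable_qform.
apply: (@continuous_comp halfline _ _ x g).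
  exact: time_derivable_continuous.
exact: differentiable_continuous.
Qed.

Lemma energy_nonincreasing M C B g x (s t : R) :
  M = M^T -> possemidefmx C -> (forall q : 'cV[R]_n, differentiable g q) ->
  is_solution M C B g (fun _ => 0) x -> 0 <= s <= t ->
  energy_along M g x t <= energy_along M g x s.
Proof.
move=> sM pC dg sol /andP[s0 st].
have dE y : y \in `]s, t[%R ->
    is_derive y 1 (energy_along M g x)
      (- bform C (time_deriv x y) (time_deriv x y)).
  rewrite in_itv/= => /andP[sy _].
  by apply: is_derive_energy sol _ => //; exact: le_lt_trans sy.
apply: (@ler0_derive1_le_cc _ (energy_along M g x) s t) => //.
- by move=> y /dE d; exact: ex_derive.
- by move=> y /dE d; rewrite derive1E derive_val oppr_le0; exact: pC.
- apply: continuous_subspaceW (continuous_energy M C B g x dg sol) => y /=.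
  by rewrite !in_itv/= => /andP[/(le_trans s0)->].
- by rewrite in_itv/= st lexx.
- by rewrite in_itv/= lexx st.
Qed.

End Energy.

(** * Boundedness *)

Theorem theorem1 (R : realType) (r nu : nat) (hr : (1 <= r)%N)
    (hnu : (1 <= nu)%N) (M C : 'M[R]_r) (B : 'M[R]_(r, nu))
    (g : 'cV[R]_r -> R) (hg : forall x : 'cV[R]_r, differentiable g x)
    (hM : M = M^T /\ posdefmx M)
    (hC : C = C^T /\ possemidefmx C)
    (hg_rad : radially_unbounded g) (hg_psd : possemidef_fun g) :
  globally_uniformly_bounded M C B g.
Proof.
case: hM hC hg_psd => sM pM [_ pC] [g00 gpos] z0.
have g_ge0 q : 0 <= g q.
  by have [->|/gpos//] := eqVneq q 0; rewrite g00.
pose e := energy M g (usubmx z0) (dsubmx z0).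
(* A level strictly above [e], so that [g q <= e] forces [enorm q < rho]. *)
have [rho rhoP] := hg_rad (e + 1).
exists (Num.sqrt (rho ^+ 2 + \tr (invmx M) * (2 * e))) => x sol xz0 t t0.
have E_le : energy M g (x t) (time_deriv x t) <= e.
  rewrite /e -xz0 /full_state col_mxKu col_mxKd.
  by apply: (energy_nonincreasing M C B) => //; rewrite lexx.
have kin_ge0 := posdefmx_ge0 M (time_deriv x t) pM.
have pot_ge0 := g_ge0 (x t).
rewrite /energy in E_le.
have x_le : enorm (x t) <= rho.
  by rewrite leNgt; apply/negP => /ltW/rhoP; lra.
have v_le : bform M (time_deriv x t) (time_deriv x t) <= 2 * e by lra.
have enormE n (w : 'cV[R]_n) : enorm w = Num.sqrt (enorm w ^+ 2).
  by rewrite sqrtr_sqr ger0_norm ?sqrtr_ge0.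
rewrite enormE ler_wsqrtr// enorm_col_mx lerD//.
  by rewrite ler_sqr ?nnegrE ?sqrtr_ge0// (le_trans _ x_le) ?sqrtr_ge0.
apply: le_trans (enorm_sqr_le_qform M _ sM pM) _.
by apply: ler_wpM2l => //; exact: tr_invmx_ge0.
Qed.
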